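(* Let $\Lambda$ be an arbitrary ring. Suppose that cotorsion on left $\Lambda$-modules splits off as a functor, i.e., the exact sequence $0\to\mathfrak{q}^{-1}\to\mathbf{1}\to\mathfrak{q}\to0$ of endofunctors of the category of left $\Lambda$-modules splits. Then $\mathfrak{q}=0$, i.e., $\Lambda$ is left selfinjective.
   Context: Let $\iota:\Lambda\to I$ be the injective envelope of $\Lambda$ viewed as a left $\Lambda$-module. For a left $\Lambda$-module $C$, the cotorsion module $\mathfrak{q}(C)$ of $C$ is the cokernel of the map $\mathrm{Hom}_\Lambda(I,C)\to\mathrm{Hom}_\Lambda(\Lambda,C)$ given by precomposition with $\iota$; equivalently, it is the quotient of $\mathrm{Hom}_\Lambda(\Lambda,C)$ by the subgroup of all maps $\Lambda\to C$ factoring through injective left modules. Via $\mathrm{Hom}_\Lambda(\Lambda,C)\cong C$, $f\mapsto f(1)$, $\mathfrak{q}$ is a quotient functor of the identity functor $\mathbf{1}$ on left $\Lambda$-modules. $\mathfrak{q}^{-1}$ denotes the kernel of $\mathbf{1}\to\mathfrak{q}$. The sequence splits if it is split by natural transformations. $\Lambda$ is left selfinjective if ${}_\Lambda\Lambda$ is an injective module. *)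

(* Defs.v *)
From HB Require Import structures.
From mathcomp Require Import all_boot all_algebra boolp.

Set Implicit Arguments.
Unset Strict Implicit.
Unset Printing Implicit Defensive.

Import GRing.Theory.
Local Open Scope ring_scope.
Local Open Scope quotient_scope.

(* Rings are [pzRingType]s: associative and unital, not necessarily
   commutative, the zero ring allowed; [lmodType R] is the type of left
   R-modules, and [R^o] is R as a left module over itself. *)

Definition injective_module (R : pzRingType) (M : lmodType R) : Prop :=
  forall (A B : lmodType R) (i : {linear A -> B}) (f : {linear A -> M}),
    injective i -> exists g : {linear B -> M}, forall a, g (i a) = f a.

Definition essential (R : pzRingType) (M N : lmodType R)
    (i : {linear M -> N}) : Prop :=
  forall S : submodClosed N, (exists2 y, y \in S & y != 0) ->
    exists2 x, i x \in S & i x != 0.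

Definition left_selfinjective (R : pzRingType) : Prop :=
  injective_module (R^o : lmodType R).

Record injective_envelope (R : pzRingType) (M : lmodType R) :=
  InjectiveEnvelope {
    env_obj :> lmodType R;
    env_map : {linear M -> env_obj};
    env_injective : injective_module env_obj;
    env_mono : injective env_map;
    env_essential : essential env_map }.

Arguments env_map {R M} i.

Section Functors.
Variable R : pzRingType.

Record endofunctor := Endofunctor {
  fobj :> lmodType R -> lmodType R;
  fmap : forall C D : lmodType R, {linear C -> D} -> {linear fobj C -> fobj D};
  fmap_id : forall C : lmodType R, fmap (idfun : {linear C -> C}) =1 id;
  fmap_comp : forall (C D K : lmodType R)
      (g : {linear D -> K}) (f : {linear C -> D}),
    fmap (g \o f : {linear C -> K}) =1 fmap g \o fmap f }.

Record nat_trans (F G : endofunctor) := NatTrans {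
  component :> forall C : lmodType R, {linear F C -> G C};
  naturality : forall (C D : lmodType R) (f : {linear C -> D}),
    component D \o fmap F f =1 fmap G f \o component C }.

Definition identity_functor : endofunctor :=
  @Endofunctor (fun C => C) (fun _ _ f => f)
    (fun _ _ => erefl) (fun _ _ _ _ _ _ => erefl).

Definition is_zero_functor (F : endofunctor) : Prop :=
  forall (C : lmodType R) (x : F C), x = 0.

(* Exactness in the category of endofunctors is componentwise. *)
Definition short_exact (F G H : endofunctor)
    (i : nat_trans F G) (p : nat_trans G H) : Prop :=
  forall C : lmodType R,
    [/\ injective (i C),
        forall y : G C, p C y = 0 <-> exists x, i C x = y
      & forall z : H C, exists y, p C y = z].

Definition split_short_exact (F G H : endofunctor)
    (i : nat_trans F G) (p : nat_trans G H) : Prop :=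
  short_exact i p /\
  exists s : nat_trans H G, forall C : lmodType R, cancel (s C) (p C).

(* A section of p yields a retraction of i. *)
Lemma split_retraction (F G H : endofunctor)
    (i : nat_trans F G) (p : nat_trans G H) :
  short_exact i p ->
  (exists s : nat_trans H G, forall C : lmodType R, cancel (s C) (p C)) ->
  exists r : nat_trans G F, forall C : lmodType R, cancel (i C) (r C).
Proof.
move=> ex [s sK].
have im C (y : G C) : exists x, i C x = y - s C (p C y).
  have [_ ker _] := ex C; apply/ker.
  by rewrite linearB /= sK subrr.
pose r C (y : G C) : F C := projT1 (cid (im C y)).
have rE C (y : G C) : i C (r C y) = y - s C (p C y).
  by rewrite /r; case: (cid _).
have iI C : injective (i C) by have [] := ex C.
have rL C : linear (@r C).
  move=> a u v; apply: iI; rewrite linearP !rE 2!(linearP (p C), linearP (s C)).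
  by rewrite scalerBr opprD addrACA.
pose rlin C : {linear G C -> F C} :=
  HB.pack (@r C) (GRing.isLinear.Build _ _ _ _ (@r C) (rL C)).
have rN (C D : lmodType R) (f : {linear C -> D}) :
    rlin D \o fmap G f =1 fmap F f \o rlin C.
  move=> y; apply: iI; rewrite /= rE.
  have /= -> := naturality i f (r C y); rewrite rE linearB /=.
  have /= -> := naturality p f y.
  by have /= -> := naturality s f (p C y).
exists (NatTrans rN) => C x; apply: iI; rewrite /= rE.
have [_ ker _] := ex C.
have -> : p C (i C x) = 0 by apply/ker; exists x.
by rewrite linear0 subr0.
Qed.

End Functors.

Section QuotientModule.
Variables (R : pzRingType) (V : lmodType R) (S : submodClosed V).

Fact submod_zmod_closed : zmod_closed (S : {pred V}).
Proof.
by split=> [|x y xS yS]; rewrite ?rpred0// rpredD// -scaleN1r rpredZ.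
Qed.

Definition submod_zmod : zmodClosed V :=
  HB.pack (S : {pred V})
    (GRing.isZmodClosed.Build V (S : {pred V}) submod_zmod_closed).

Definition quot_module : Type := Quotient.quot submod_zmod.

HB.instance Definition _ := GRing.Zmodule.on quot_module.

Definition quot_pi (x : V) : quot_module := \pi_(Quotient.quot submod_zmod) x.

Lemma quot_pi_eq x y : quot_pi x = quot_pi y <-> x - y \in S.
Proof.
rewrite (Quotient.idealrBE submod_zmod x y : (x - y \in S) = _).
by split=> [/eqP|/eqP].
Qed.

Lemma quot_pi_surj z : exists x, quot_pi x = z.
Proof. by exists (repr z); rewrite /quot_pi reprK. Qed.

Fact quot_piB : {morph quot_pi : x y / x - y}.
Proof. exact: (raddfB (\pi_(Quotient.quot submod_zmod))). Qed.

Fact quot_piD : {morph quot_pi : x y / x + y}.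
Proof. exact: (raddfD (\pi_(Quotient.quot submod_zmod))). Qed.

Definition quot_scale (a : R) (z : quot_module) : quot_module :=
  quot_pi (a *: repr z).

Fact quot_scaleE a x : quot_scale a (quot_pi x) = quot_pi (a *: x).
Proof.
apply/quot_pi_eq; rewrite -scalerBr; apply: rpredZ; apply/quot_pi_eq.
by rewrite /quot_pi reprK.
Qed.

Fact quot_scaleA a b z : quot_scale a (quot_scale b z) = quot_scale (a * b) z.
Proof. by have [x <-] := quot_pi_surj z; rewrite !quot_scaleE scalerA. Qed.

Fact quot_scale1 : left_id 1 quot_scale.
Proof. by move=> z; have [x <-] := quot_pi_surj z; rewrite quot_scaleE scale1r. Qed.

Fact quot_scaleDr : right_distributive quot_scale +%R.
Proof.
move=> a z t; have [x <-] := quot_pi_surj z; have [y <-] := quot_pi_surj t.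
by rewrite -quot_piD !quot_scaleE scalerDr quot_piD.
Qed.

Fact quot_scaleDl z : {morph quot_scale^~ z : a b / a + b}.
Proof.
move=> a b; have [x <-] := quot_pi_surj z.
by rewrite !quot_scaleE scalerDl quot_piD.
Qed.

HB.instance Definition _ := GRing.Zmodule_isLmodule.Build R quot_module
  quot_scaleA quot_scale1 quot_scaleDr quot_scaleDl.

Fact quot_pi_linear : linear quot_pi.
Proof. by move=> a x y; rewrite quot_piD -quot_scaleE. Qed.

HB.instance Definition _ := GRing.isLinear.Build R V quot_module _ quot_pi
  quot_pi_linear.

End QuotientModule.

Section SubModule.
Variables (R : pzRingType) (V : lmodType R) (S : submodClosed V).

Record sub_module : Type := SubModule { sub_incl :> V; _ : sub_incl \in S }.

HB.instance Definition _ := [isSub for sub_incl].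
HB.instance Definition _ := [Choice of sub_module by <:].
HB.instance Definition _ := [SubChoice_isSubLmodule of sub_module by <:].

Fact sub_incl_linear : linear sub_incl.
Proof. exact: (linearP (val : sub_module -> V)). Qed.

HB.instance Definition _ := GRing.isLinear.Build R sub_module V _ sub_incl
  sub_incl_linear.

Lemma sub_incl_inj : injective sub_incl.
Proof. exact: val_inj. Qed.

End SubModule.

Section Cotorsion.
Variables (R : pzRingType) (E : injective_envelope (R^o : lmodType R)).

(* f lies in the image of Hom(I, C) -> Hom(R, C), g |-> g \o iota. *)
Definition extends_to_envelope (C : lmodType R) (f : {linear R^o -> C}) : Prop :=
  exists g : {linear E -> C}, forall a : R^o, f a = g (env_map E a).

(* Image of the previous subgroup under Hom(R, C) ~ C, f |-> f 1. *)
Definition qinv_pred (C : lmodType R) : {pred C} :=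
  fun x => `[< exists2 f : {linear R^o -> C}, extends_to_envelope f & f 1 = x >].
Arguments qinv_pred : clear implicits.

Section Closed.
Variable C : lmodType R.

Definition rmul (a : R) (y : R^o) : R^o := (y : R) * a.

Fact rmul_linear a : linear (rmul a).
Proof. by move=> k u v; rewrite /rmul mulrDl -mulrA. Qed.

HB.instance Definition _ a := GRing.isLinear.Build R R^o R^o _ (rmul a)
  (rmul_linear a).

Fact qinv_submod_closed : submod_closed (qinv_pred C).
Proof.
split.
  apply/asboolP; exists (\0 : {linear R^o -> C}) => //.
  by exists (\0 : {linear E -> C}).
move=> a x y /asboolP[f [g fg] f1] /asboolP[f' [g' fg'] f'1]; apply/asboolP.
have [h hE] := env_injective (env_map E \o rmul a : {linear R^o -> E})
                 (@env_mono _ _ E).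
exists ((f \o rmul a) \+ f' : {linear R^o -> C}).
  exists ((g \o h) \+ g' : {linear E -> C}) => b /=.
  by rewrite hE /= -fg -fg'.
rewrite /= /rmul mul1r f'1 -f1; congr (_ + _).
by rewrite -linearZ /=; congr (f _); rewrite /GRing.scale /= mulr1.
Qed.

HB.instance Definition _ := GRing.isSubmodClosed.Build R C (qinv_pred C)
  qinv_submod_closed.

End Closed.

Definition qinv_obj (C : lmodType R) : lmodType R := sub_module (qinv_pred C).
Definition q_obj (C : lmodType R) : lmodType R := quot_module (qinv_pred C).

Section Map.
Variables (C D : lmodType R) (f : {linear C -> D}).

Fact qinv_stable x : x \in qinv_pred C -> f x \in qinv_pred D.
Proof.
move=> /asboolP[h [g hg] h1]; apply/asboolP.
exists (f \o h : {linear R^o -> D}); last by rewrite /= h1.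
by exists (f \o g : {linear E -> D}) => a /=; rewrite hg.
Qed.

Definition qinv_map_fun (x : qinv_obj C) : qinv_obj D :=
  SubModule (qinv_stable (valP x)).

Fact qinv_map_linear : linear qinv_map_fun.
Proof. by move=> a x y; apply: val_inj; rewrite /= linearP. Qed.

HB.instance Definition _ := GRing.isLinear.Build R (qinv_obj C) (qinv_obj D) _
  qinv_map_fun qinv_map_linear.

Definition q_map_fun (z : q_obj C) : q_obj D := quot_pi _ (f (repr z)).

Lemma q_map_pi x : q_map_fun (quot_pi _ x) = quot_pi _ (f x).
Proof.
apply/quot_pi_eq; rewrite -linearB; apply: qinv_stable; apply/quot_pi_eq.
by rewrite /quot_pi reprK.
Qed.

Fact q_map_linear : linear q_map_fun.
Proof.
move=> a z t; have [x <-] := quot_pi_surj z; have [y <-] := quot_pi_surj t.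
by rewrite -linearP !q_map_pi !linearP.
Qed.

HB.instance Definition _ := GRing.isLinear.Build R (q_obj C) (q_obj D) _
  q_map_fun q_map_linear.

End Map.

Fact qinv_map_id (C : lmodType R) :
  qinv_map_fun (idfun : {linear C -> C}) =1 id.
Proof. by move=> x; apply: val_inj. Qed.

Fact qinv_map_comp (C D K : lmodType R)
    (g : {linear D -> K}) (f : {linear C -> D}) :
  qinv_map_fun (g \o f : {linear C -> K}) =1 qinv_map_fun g \o qinv_map_fun f.
Proof. by move=> x; apply: val_inj. Qed.

Fact q_map_id (C : lmodType R) : q_map_fun (idfun : {linear C -> C}) =1 id.
Proof. by move=> z; have [x <-] := quot_pi_surj z; rewrite q_map_pi. Qed.

Fact q_map_comp (C D K : lmodType R)
    (g : {linear D -> K}) (f : {linear C -> D}) :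
  q_map_fun (g \o f : {linear C -> K}) =1 q_map_fun g \o q_map_fun f.
Proof.
move=> z; have [x <-] := quot_pi_surj z.
by rewrite (q_map_pi (g \o f)) /= (q_map_pi f) (q_map_pi g).
Qed.

Definition qinv : endofunctor R :=
  @Endofunctor R qinv_obj (fun C D f => qinv_map_fun f) qinv_map_id qinv_map_comp.

Definition q : endofunctor R :=
  @Endofunctor R q_obj (fun C D f => q_map_fun f) q_map_id q_map_comp.

Definition qinv_incl : nat_trans qinv (identity_functor R) :=
  @NatTrans R qinv (identity_functor R)
    (fun C => sub_incl (S := qinv_pred C)) (fun _ _ _ _ => erefl).

Definition q_proj : nat_trans (identity_functor R) q :=
  @NatTrans R (identity_functor R) q
    (fun C => quot_pi (qinv_pred C)) (fun C D f x => esym (q_map_pi f x)).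

Lemma q_exact : short_exact qinv_incl q_proj.
Proof.
move=> C; split; [exact: sub_incl_inj | | move=> z; exact: quot_pi_surj].
move=> y; rewrite -(linear0 (q_proj C)); split=> [/quot_pi_eq|[x <-]].
  by rewrite subr0 => yS; exists (SubModule yS).
by apply/quot_pi_eq; rewrite subr0; case: x.
Qed.

(* f |-> [f 1] identifies q C with the quotient of Hom(R, C) by the maps that
   extend along R -> I, equivalently by those that factor through some
   injective module. *)
Lemma q_proj_eval_eq0 (C : lmodType R) (f : {linear R^o -> C}) :
  q_proj C (f 1) = 0 <-> extends_to_envelope f.
Proof.
rewrite -(linear0 (q_proj C)); split=> [/quot_pi_eq|fE]; last first.
  by apply/quot_pi_eq; rewrite subr0; apply/asboolP; exists f.
rewrite subr0 => /asboolP[f' [g f'g] f'1]; exists g => a; rewrite -f'g.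
have aE : a = a *: (1 : R^o) by rewrite /GRing.scale /= mulr1.
by rewrite aE !linearZ /= f'1.
Qed.

Lemma extends_to_envelopeP (C : lmodType R) (f : {linear R^o -> C}) :
  extends_to_envelope f <->
  exists (J : lmodType R) (u : {linear R^o -> J}) (v : {linear J -> C}),
    injective_module J /\ f =1 v \o u.
Proof.
split=> [[g fg]|[J [u [v [Jinj fvu]]]]].
  by exists E, (env_map E), g; split=> //; exact: env_injective.
have [w wE] := Jinj _ _ _ u (@env_mono _ _ E).
by exists (v \o w : {linear E -> C}) => a; rewrite /= wE fvu.
Qed.

End Cotorsion.

(* Main.v *)
Require Import Defs.
From HB Require Import structures.
From mathcomp Require Import all_boot all_algebra.

(* Let s be the section. The element iota 1 of the injective module E has zero
   cotorsion class, so naturality of s along iota gives iota (s [1]) = s [iota 1]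
   = 0. As iota and s are injective, [1] = 0 in q R. Naturality along the map
   R -> C sending 1 to x then gives q = 0, and [1] = 0 in q R means that the
   identity of R extends to E, making R a retract of E. *)

Set Implicit Arguments.
Unset Strict Implicit.
Unset Printing Implicit Defensive.

Import GRing.Theory.
Local Open Scope ring_scope.

Lemma injective_retract (R : pzRingType) (M N : lmodType R)
    (i : {linear M -> N}) (r : {linear N -> M}) :
  cancel i r -> injective_module N -> injective_module M.
Proof.
move=> iK Ninj A B j f jI.
have [g gE] := Ninj _ _ j (i \o f : {linear A -> N}) jI.
by exists (r \o g : {linear B -> M}) => a; rewrite /= gE /= iK.
Qed.

Section ScaleVector.
Variables (R : pzRingType) (C : lmodType R) (x : C).

(** The map that corresponds to [x] under Hom(R, C) ~ C, f |-> f 1. *)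
Definition scale_vector (a : R^o) : C := (a : R) *: x.

Fact scale_vector_linear : linear scale_vector.
Proof. by move=> k a b; rewrite /scale_vector scalerDl -scalerA. Qed.

HB.instance Definition _ := GRing.isLinear.Build R R^o C _ scale_vector
  scale_vector_linear.

End ScaleVector.

Section Cotorsion.
Variables (R : pzRingType) (E : injective_envelope (R^o : lmodType R)).

(** The map R -> J with 1 |-> [x] factors through the injective [J] itself, followed by the
    identity. *)
Lemma q_proj_injective_eq0 (J : lmodType R) (x : J) :
  injective_module J -> q_proj E J x = 0.
Proof.
move=> Jinj; rewrite -[x]scale1r.
apply/(q_proj_eval_eq0 E (scale_vector x : {linear R^o -> J})).
apply/extends_to_envelopeP.
by exists J, (scale_vector x : {linear R^o -> J}), idfun.
Qed.

Lemma is_zero_q : q_proj E R^o (1 : R) = 0 -> is_zero_functor (q E).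
Proof.
move=> q1 C z; have [_ _ /(_ z)[x <-]] := q_exact E C.
have := naturality (q_proj E) (scale_vector x : {linear R^o -> C}) (1 : R).
by rewrite [RHS]/comp q1 linear0 /= /scale_vector scale1r.
Qed.

Lemma left_selfinjective_q : q_proj E R^o (1 : R) = 0 -> left_selfinjective R.
Proof.
(* The extension [r] of the identity to [E] is a retraction of iota. *)
move/(q_proj_eval_eq0 E (idfun : {linear R^o -> R^o})) => [r rE].
apply: (@injective_retract _ _ _ (env_map E) r); last exact: env_injective.
by move=> a; rewrite -rE.
Qed.

Lemma q_proj1_split (s : nat_trans (q E) (identity_functor R)) :
  cancel (s R^o) (q_proj E R^o) -> q_proj E R^o (1 : R) = 0.
Proof.
(* Cancelling [s] and then iota leaves iota (s [1]) = iota (s 0). *)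
move=> sK; apply: (can_inj sK); apply: (@env_mono _ _ E).
have /= <- := naturality s (env_map E) (q_proj E R^o (1 : R)).
(* The image of [1] under q(iota) is [iota 1], a class in q of an injective module. *)
have /= <- := naturality (q_proj E) (env_map E) (1 : R).
have /= -> := q_proj_injective_eq0 (env_map E (1 : R)) (@env_injective _ _ E).
by rewrite !linear0.
Qed.

End Cotorsion.

Theorem corollary3p29 (R : pzRingType)
    (E : injective_envelope (R^o : lmodType R)%type) :
  split_short_exact (qinv_incl E) (q_proj E) ->
  is_zero_functor (q E) /\ left_selfinjective R.
Proof.
move=> [_ [s sK]]; have q1 := q_proj1_split (sK R^o).
by split; [exact: is_zero_q | exact: left_selfinjective_q q1].
Qed.
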